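(* (i) For every graph $G$ of order $n$ with minimum degree $\delta(G)=4$, the inequality $\gamma_g(G)\le \dfrac{37n}{72}$ holds. (ii) For every graph $G$ of order $n$ with minimum degree $\delta(G)\ge 5$, the inequality $\gamma_g(G)\le \dfrac{2102n}{4377}$ holds.
   Context: Graphs are finite, simple and undirected; the order of $G=(V,E)$ is $|V|$, and $\delta(G)$ is the minimum degree of $G$. For $v\in V$, $N(v)=\{u: uv\in E\}$ and $N[v]=N(v)\cup\{v\}$; for $S\subseteq V$, $N[S]=\bigcup_{v\in S}N[v]$ is the set of vertices dominated by $S$. The domination game on $G$: two players, Dominator and Staller, alternately select a vertex of $G$. If $D$ is the set of vertices selected so far (by both players), then selecting $v$ is legal if and only if it dominates at least one new vertex, i.e. $N[v]\not\subseteq N[D]$. The game ends when no legal move exists, equivalently when $N[D]=V$. The length of the game is the total number of vertices selected (the number of turns, a turn being one move of one player). Dominator wants to minimize the length and Staller wants to maximize it. The game domination number $\gamma_g(G)$ is the length of the game when Dominator makes the first move and both players play optimally. *)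

(* Defs.v *)
From mathcomp Require Import all_boot all_order all_algebra.

Set Implicit Arguments.
Unset Strict Implicit.
Unset Printing Implicit Defensive.

(* A finite simple graph is an adjacency relation [e] on a vertex type
   [T : finType], together with the hypotheses [symmetric e] and
   [irreflexive e]. *)
Section DominationGame.

Variables (T : finType) (e : rel T).
Implicit Types (v : T) (D S : {set T}).

Definition nbh v : {set T} := [set u | e u v].

Definition cnbh v : {set T} := v |: nbh v.

Definition dominated S : {set T} := \bigcup_(v in S) cnbh v.

Definition degree v : nat := #|nbh v|.

(* In a simple graph every degree is smaller than [#|T|], so the default value
   matters only for the graph without vertices, whose minimum degree is 0. *)
Definition min_degree : nat := \big[minn/#|T|]_(v : T) degree v.

(* [D] is the set of vertices selected so far, by either player. *)
Definition legal D v : bool := ~~ (cnbh v \subset dominated D).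

(* Number of further moves under optimal play when the vertices of [D] have
   been selected and Dominator ([dom_turn]) or Staller is to move.
   The recursion is bounded by [k]; since each legal move dominates a new
   vertex, the bound is irrelevant once [k] is at least the number of
   undominated vertices ([game_length_bound] below). The
   default [k'] of the minimum never matters ([game_length_le], [game_lengthS]). *)
Fixpoint game_length (k : nat) (dom_turn : bool) (D : {set T}) : nat :=
  if k is k'.+1 then
    if [exists v, legal D v] then
      (if dom_turn
       then \big[minn/k']_(v | legal D v) game_length k' false (v |: D)
       else \max_(v | legal D v) game_length k' true (v |: D)).+1
    else 0
  else 0.

Definition game_domination_number : nat := game_length #|T| true set0.

Lemma game_length_le k b D : game_length k b D <= k.
Proof.
elim: k b D => //= k IHk b D; case: ifP => // _; rewrite ltnS; case: b.
  by elim/big_rec: _ => // v m _ le_mk; rewrite geq_min le_mk orbT.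
by apply/bigmax_leqP.
Qed.

Lemma dominatedU1 v D : dominated (v |: D) = cnbh v :|: dominated D.
Proof. by rewrite /dominated bigcup_setU big_set1. Qed.

Lemma legal_card v D : legal D v ->
  #|~: dominated (v |: D)| < #|~: dominated D|.
Proof.
rewrite /legal => nsub; apply: proper_card; rewrite dominatedU1.
rewrite properC properE subsetUr /= subUset negb_and nsub //.
Qed.

Lemma game_length_over b D k : ~~ [exists v, legal D v] ->
  game_length k b D = 0.
Proof. by case: k => //= k /negbTE ->. Qed.

Lemma legalPn D : reflect (dominated D = setT) (~~ [exists v, legal D v]).
Proof.
apply: (iffP existsPn) => [H | domD v]; last by rewrite /legal domD subsetT.
apply/setP=> v; rewrite inE; move: (H v); rewrite negbK => /subsetP; apply.
by rewrite !inE eqxx.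
Qed.

Lemma game_lengthS k D : [exists v, legal D v] ->
  [/\ exists2 v, legal D v &
        game_length k.+1 true D = (game_length k false (v |: D)).+1,
      forall v, legal D v ->
        game_length k.+1 true D <= (game_length k false (v |: D)).+1,
      exists2 v, legal D v &
        game_length k.+1 false D = (game_length k true (v |: D)).+1
    & forall v, legal D v ->
        (game_length k true (v |: D)).+1 <= game_length k.+1 false D].
Proof.
move=> ex; rewrite /= ex; have [v0 lv0] := existsP ex.
pose F v := game_length k false (v |: D).
have lemin v : legal D v -> \big[minn/k]_(v | legal D v) F v <= F v.
  by move=> lv; rewrite -leEnat -minEnat; apply: Order.TotalTheory.bigmin_le_cond.
split.
- have [v lv Ev] := @Order.TotalTheory.eq_bigmin _ _ _ (k : nat) v0 (legal D) F
    lv0 (fun v _ => game_length_le k false (v |: D)).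
  by exists v => //; congr _.+1.
- by move=> v lv; rewrite ltnS; apply: lemin.
- have [|v lv ->] := @eq_bigmax_cond _ (legal D)
    (fun v => game_length k true (v |: D)); first by apply/card_gt0P; exists v0.
  by exists v.
- move=> v lv; rewrite ltnS.
  exact: (@leq_bigmax_cond _ (legal D) (fun v => game_length k true (v |: D))).
Qed.

Lemma game_length_bound k l b D :
    #|~: dominated D| <= k -> #|~: dominated D| <= l ->
  game_length k b D = game_length l b D.
Proof.
have [ex|over] := boolP [exists v, legal D v]; last first.
  by rewrite !game_length_over.
elim: k l b D ex => [|k IHk] l b D ex lek lel.
  have /existsP[v /legal_card] := ex.
  by rewrite ltnNge (leq_trans lek).
have IH c v : legal D v ->
    game_length k c (v |: D) = game_length l.-1 c (v |: D).
  move=> /legal_card lv.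
  have [ex'|over] := boolP [exists w, legal (v |: D) w]; last first.
    by rewrite !game_length_over.
  apply: IHk => //; first exact: leq_trans lv lek.
  by move: (leq_trans lv lel); case: (l).
case: l lel IH => [|l] lel IH.
  have /existsP[v /legal_card] := ex.
  by rewrite ltnNge (leq_trans lel).
have [[v lv Ev] minv [w lw Ew] maxw] := game_lengthS k ex.
have [[v' lv' Ev'] minv' [w' lw' Ew'] maxw'] := game_lengthS l ex.
apply/eqP; rewrite eqn_leq; case: b; apply/andP; split.
- by rewrite Ev' -(IH _ _ lv'); apply: minv.
- by rewrite Ev (IH _ _ lv); apply: minv'.
- by rewrite Ew (IH _ _ lw); apply: maxw'.
- by rewrite Ew' -(IH _ _ lw'); apply: maxw.
Qed.

End DominationGame.

(* Main.v *)
Require Import Defs.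
From mathcomp Require Import all_boot all_order all_algebra.
From mathcomp Require Import zify.

Set Implicit Arguments.
Unset Strict Implicit.
Unset Printing Implicit Defensive.

(** Call a vertex white while it is undominated.  The game is measured by a
    potential: every white vertex weighs [a], every dominated vertex with [i]
    white neighbours weighs [b i], where [b 0 = 0].  The potential starts at
    [a * n] and never becomes negative, so the game lasts at most [a * n / c]
    turns as soon as Dominator has, on each of his turns, a move that lowers the
    potential by at least [c] and that, together with any reply of Staller,
    lowers it by at least [2 * c] ([potential_strategy]).

    All estimates come from one inequality, [potential_drop].  A move [v]
    removes the weight of [v]; each other newly dominated vertex trades its
    weight [a] for a smaller one; and each edge from a newly dominated vertex to
    a dominated vertex other than [v] lowers the latter by at least the
    slope [s] of [b].  Minimum degree [d] makes these edges numerous: a white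
    vertex with at most [x] white neighbours sends at least [d - x] of them.

    The game is split in two phases.  While some move dominates at least five
    new vertices, Dominator plays it, and [b] is constant, equal to [B], on
    positive arguments: this lowers the potential by at least
    [a + 4 * (a - B)], and any reply lowers it by at least [a] ([flat_drop]).
    Afterwards white vertices have at most 3 white neighbours and dominated ones
    at most 4, forever.  The values
    [b 1], ..., [b 4] may then be chosen increasing and at most [B], so that
    switching to them does not raise the potential ([potential_flat]), and now
    edges to dominated vertices count.  In this second phase ([sparse_good])
    Dominator thins out the white vertices before the dominated ones: he plays
    a white vertex with 3, then with 2 white neighbours, then a dominated vertex
    with 4 or 3, then a white vertex with 1, a dominated vertex with 2, and at
    last an isolated white vertex.  With white degrees already low, playing a
    dominated vertex turns its white neighbours into light ones; in the other
    order, heavy ones would remain.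

    What remains is arithmetic on the weights ([balanced]).  The ratio [a / c]
    is limited at both ends.  At the end of the game every component may be
    a star with a white centre and [d] leaves of weight [b 1], which needs
    [2 * c <= 2 * (a + d * b 1)]; the other stages force [b 2], [b 3], [b 4] up
    from [b 1]; the first phase needs [4 * B <= 6 * a - 2 * c], and [b 4 <= B].
    The weights of [balanced4] and [balanced5] meet all constraints with
    [a / c = 148 / 288 = 37 / 72] and [a / c = 2102 / 4377]. *)

(** * Numerical constraints on the weights *)

Section Gains.
Variables (d a c : nat) (b : nat -> nat).

Definition steep (s y : nat) : bool :=
  all (fun i => b i + s <= b i.+1) (iota 0 y).

Lemma steepP s y i j : steep s y -> i <= j <= y -> b i + (j - i) * s <= b j.
Proof.
move=> /allP st; elim: j => [|j IHj] /andP[le_ij le_jy].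
  by move: le_ij; rewrite leqn0 => /eqP->; rewrite mul0n addn0.
move: le_ij; rewrite leq_eqVlt => /predU1P[->|lt_ij]; first by rewrite subnn addn0.
have := st j; rewrite mem_iota /= => /(_ le_jy) stj.
have := IHj; rewrite -ltnS lt_ij ltnW // => /(_ isT).
by rewrite subSn // mulSn; lia.
Qed.

Lemma steep_mono s y i j : steep s y -> i <= j <= y -> b i <= b j.
Proof. by move=> st /(steepP st); apply: leq_trans; apply: leq_addr. Qed.

(** Guaranteed drop when a white vertex with [x] white neighbours is played and
    no white vertex has more of them: these neighbours lose one white
    neighbour, and each of the [x.+1] newly dominated vertices sends
    [d - x] edges to dominated vertices. *)
Definition white_gain (s x : nat) : nat :=
  a + x * (a - b x.-1) + x.+1 * (d - x) * s.

(** Guaranteed drop when a dominated vertex with [y] white neighbours is played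
    and no white vertex has more than [x]: one edge of each newly dominated
    vertex leads back to the played vertex, hence [d.-1]. *)
Definition dominated_gain (s x y : nat) : nat :=
  b y + y * (a - b x + (d.-1 - x) * s).

(** The two kinds of least profitable moves, among which Staller chooses. *)
Definition any_gain (s x : nat) : nat :=
  minn (white_gain s 0) (dominated_gain s x 1).

Definition profitable (s x y g : nat) : bool :=
  [&& x <= y, steep s y, b x + s <= a, c <= g & 2 * c <= g + any_gain s x].

(** The slope that may be used depends on how many white neighbours dominated
    vertices can still have: [s4] for four, [s2] for two, and [b 1] for one. *)
Definition balanced (B s2 s4 : nat) : bool :=
  [&& b 0 == 0, all (fun i => b i <= B) (iota 0 5), B <= a,
      c <= a + 4 * (a - B) & 2 * c <= a + 4 * (a - B) + a]
  && [&& profitable s4 3 4 (white_gain s4 3),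
         profitable s4 2 4 (white_gain s4 2),
         profitable s4 1 4 (dominated_gain s4 1 4),
         profitable s4 1 4 (dominated_gain s4 1 3),
         profitable s2 1 2 (white_gain s2 1),
         profitable s2 0 2 (dominated_gain s2 0 2)
       & profitable (b 1) 0 1 (white_gain (b 1) 0)].

End Gains.

Definition listed (b1 b2 b3 b4 : nat) : nat -> nat :=
  nth 0 [:: 0; b1; b2; b3; b4].

(** The isolated stars dictate [35 = (288 - 148) / 4]; 17 and 11 are the least
    slopes that pay for the stages that rely on them, and 78 is the largest
    flat weight allowed by the first phase. *)
Lemma balanced4 : balanced 4 148 288 (listed 35 52 63 74) 78 17 11.
Proof. by vm_compute. Qed.

(** The same recipe, starting from [455 = (4377 - 2102) / 5]. *)
Lemma balanced5 : balanced 5 2102 4377 (listed 455 678 813 948) 964 223 135.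
Proof. by vm_compute. Qed.

Section Potential.
Variables (T : finType) (e : rel T).
Hypothesis e_sym : symmetric e.
Hypothesis e_irr : irreflexive e.
Implicit Types (u v w : T) (D : {set T}).

(** * Potentials bound the length of the game *)

(** The first alternative lets Dominator hand the game over to another
    potential, lying below [F]; [P] is an invariant of play. *)
Lemma potential_strategy (c : nat) (F : {set T} -> nat) (P : {set T} -> Prop) :
    (forall D v, P D -> P (v |: D)) ->
    (forall D, P D -> [exists v, legal e D v] ->
       (forall k, c * game_length e k true D <= F D) \/
       exists2 v, legal e D v & F (v |: D) + c <= F D /\
         forall w, legal e (v |: D) w -> F (w |: (v |: D)) + 2 * c <= F D) ->
  forall k D, P D -> c * game_length e k true D <= F D.
Proof.
move=> P_up step k; have [n le_kn] := ubnP k.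
elim: n k le_kn => // n IHn [|k] lt_kn D PD; first by rewrite muln0.
have [exD|overD] := boolP [exists v, legal e D v]; last first.
  by rewrite game_length_over // muln0.
have [//|[v lv [dropv dropw]]] := step D PD exD.
have [_ /(_ v lv) lev _ _] := game_lengthS k exD.
apply: (leq_trans (n := c * (game_length e k false (v |: D)).+1)).
  by rewrite leq_mul2l lev orbT.
rewrite mulnS.
have [exv|overv] := boolP [exists w, legal e (v |: D) w]; last first.
  by rewrite game_length_over //; lia.
case: k lt_kn {lev} => [|k] lt_kn; first by rewrite /=; lia.
have [_ _ [w lw ->] _] := game_lengthS k exv.
have := dropw w lw; have := IHn k _ (w |: (v |: D)) (P_up _ _ (P_up _ _ PD)).
rewrite mulnS; lia.
Qed.

(** * White vertices and the effect of a move *)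

Definition white D : {set T} := ~: dominated e D.

Definition wdeg D v : nat := #|nbh e v :&: white D|.

Definition fresh D v : {set T} := cnbh e v :&: white D.

Lemma nbh_sym u v : (u \in nbh e v) = (v \in nbh e u).
Proof. by rewrite !inE e_sym. Qed.

Lemma in_cnbh u v : (u \in cnbh e v) = (u == v) || (u \in nbh e v).
Proof. by rewrite !inE. Qed.

Lemma whiteU1 D v : white (v |: D) = white D :\: cnbh e v.
Proof. by rewrite /white dominatedU1 setCU setIC setDE. Qed.

Lemma legalE D v : legal e D v = (fresh D v != set0).
Proof. by rewrite /legal /fresh -setD_eq0 setDE. Qed.

Lemma wdegU1 D v w : wdeg D w = wdeg (v |: D) w + #|nbh e w :&: fresh D v|.
Proof.
rewrite /wdeg whiteU1 -(cardsID (cnbh e v) (nbh e w :&: white D)) addnC setIDA.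
by congr (_ + #|pred_of_set _|); rewrite /fresh -setIA [white D :&: _]setIC.
Qed.

Lemma wdegU1_le D v w : wdeg (v |: D) w <= wdeg D w.
Proof. by rewrite (wdegU1 D v w) leq_addr. Qed.

Lemma wdegU1_self D v : wdeg (v |: D) v = 0.
Proof.
apply/eqP; rewrite cards_eq0 -subset0; apply/subsetP=> u.
by rewrite in_setI whiteU1 in_setD in_cnbh => /andP[->]; rewrite orbT.
Qed.

Lemma card_fresh D v : #|fresh D v| = (v \in white D) + wdeg D v.
Proof.
rewrite (cardsD1 v) in_setI in_cnbh eqxx /=; congr (_ + #|pred_of_set _|).
apply/setP=> u; rewrite !(in_cnbh, in_setD1, in_setI).
by have [->|] := eqVneq u v => //=; rewrite inE e_irr.
Qed.

Lemma freshD1 D v : #|fresh D v :\ v| = wdeg D v.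
Proof.
have := cardsD1 v (fresh D v); rewrite card_fresh {2}/fresh in_setI in_cnbh eqxx /=.
by move/eqP; rewrite eqn_add2l => /eqP.
Qed.

Lemma fresh_edges D v :
  \sum_(u in fresh D v) #|(nbh e u :\: white D) :\ v| =
  \sum_(w | (w \notin white D) && (w != v)) #|nbh e w :&: fresh D v|.
Proof.
transitivity (\sum_(u in fresh D v)
    \sum_(w | (w \notin white D) && (w != v) && (w \in nbh e u)) 1).
  apply: eq_bigr => u _; rewrite sum1dep_card; apply: eq_card => w.
  by rewrite in_setD1 in_setD [RHS]inE andbA [(w != v) && _]andbC.
rewrite (exchange_big_dep (fun w => (w \notin white D) && (w != v))) /=; last first.
  by move=> u w _ /andP[].
apply: eq_bigr => w nw; rewrite sum1dep_card; apply: eq_card => u.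
by rewrite nw in_setI [LHS]inE nbh_sym andbC.
Qed.

Definition weight (a : nat) (b : nat -> nat) D w : nat :=
  if w \in white D then a else b (wdeg D w).

Definition potential a b D : nat := \sum_w weight a b D w.

(** Once the edges between newly and previously dominated vertices are counted
    from the side of the latter ([fresh_edges]), the inequality holds vertex by
    vertex: a dominated vertex with [m] newly dominated neighbours loses [m]
    white neighbours, hence at least [m * s] of its weight. *)
Lemma potential_drop a b s B y D v :
    b 0 = 0 -> steep b s y -> B <= a ->
    (forall w, w \notin white D -> wdeg D w <= y) ->
    (forall u, u \in fresh D v -> u != v -> b (wdeg (v |: D) u) <= B) ->
  potential a b (v |: D) +
    (weight a b D v + wdeg D v * (a - B)
     + (\sum_(u in fresh D v) #|(nbh e u :\: white D) :\ v|) * s)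
  <= potential a b D.
Proof.
move=> b0 st leBa ley leB.
rewrite fresh_edges -freshD1 -sum_nat_const big_distrl /=.
rewrite /potential (bigD1 v) //= [X in _ <= X](bigD1 v) //=.
have -> : weight a b (v |: D) v = 0.
  by rewrite /weight whiteU1 in_setD in_cnbh eqxx wdegU1_self b0.
rewrite add0n addnC -!addnA leq_add2l.
rewrite [X in X + _](eq_bigl (fun u => (u != v) && (u \in fresh D v))); last first.
  by move=> u; rewrite in_setD1.
rewrite [X in _ + (X + _)](eq_bigl (fun w => (w != v) && (w \notin white D))); last first.
  by move=> w; rewrite andbC.
rewrite 2!big_mkcondr /= -!big_split /=; apply: leq_sum => w neq_wv.
rewrite /weight whiteU1 in_setD in_setI.
have [ww|nww] := boolP (w \in white D); rewrite ?andbT ?andbF /=.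
  have [wN|//] := boolP (w \in cnbh e v) => /=.
  have := leB w; rewrite in_setI wN ww => /(_ isT neq_wv); lia.
have := @steepP b s y (wdeg (v |: D) w) (wdeg D w) st.
rewrite wdegU1_le ley // => /(_ isT); rewrite {1}(wdegU1 D v w) addKn; lia.
Qed.

(** * Bounded numbers of white neighbours *)

Definition bounded (x y : nat) D : bool :=
  [forall w, wdeg D w <= if w \in white D then x else y].

Lemma bounded_white x y D w : bounded x y D -> w \in white D -> wdeg D w <= x.
Proof. by move=> /forallP/(_ w); case: ifP. Qed.

Lemma bounded_dominated x y D w :
  bounded x y D -> w \notin white D -> wdeg D w <= y.
Proof. by move=> /forallP/(_ w); case: ifP. Qed.

(** A white vertex that gets dominated falls under the bound [y], whence the
    condition [x <= y]. *)
Lemma boundedU1 x y D v : x <= y -> bounded x y D -> bounded x y (v |: D).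
Proof.
move=> le_xy /forallP bD; apply/forallP=> w.
apply: leq_trans (wdegU1_le D v w) _; have := bD w.
rewrite whiteU1 in_setD; case: (w \in white D); rewrite ?andbF ?andbT //.
by case: ifP => // _ /leq_trans->.
Qed.

Lemma bounded_white_step x y D : bounded x.+1 y D ->
  (exists2 v, v \in white D & wdeg D v = x.+1) \/ bounded x y D.
Proof.
move=> bD; have [/exists_inP[v wv /eqP]|] :=
  boolP [exists v in white D, wdeg D v == x.+1]; first by left; exists v.
move=> /exists_inPn no; right; apply/forallP=> w.
have /forallP/(_ w) := bD; case: ifP => // ww.
by rewrite leq_eqVlt (negbTE (no w ww)).
Qed.

Lemma bounded_dominated_step x y D : bounded x y.+1 D ->
  (exists2 v, v \notin white D & wdeg D v = y.+1) \/ bounded x y D.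
Proof.
move=> bD; have [/existsP[v /andP[wv /eqP]]|] :=
  boolP [exists v, (v \notin white D) && (wdeg D v == y.+1)]; first by left; exists v.
move=> /existsPn no; right; apply/forallP=> w.
have /forallP/(_ w) := bD; have := no w; case: ifP => //= _.
by rewrite leq_eqVlt => /negbTE->.
Qed.

(** * Gains of the possible moves *)

Section Moves.
Variables (d a : nat) (b : nat -> nat).
Hypothesis min_deg : forall v, d <= #|nbh e v|.
Hypothesis b0 : b 0 = 0.
Local Notation pot := (potential a b).

Lemma outer_degree D v u :
  d - wdeg D u - (v \notin white D) <= #|(nbh e u :\: white D) :\ v|.
Proof.
have := cardsD1 v (nbh e u :\: white D); have := cardsID (white D) (nbh e u).
rewrite -/(wdeg D u) in_setD; have := min_deg u.
by case: (v \in white D) => /=; case: (v \in nbh e u) => /=; lia.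
Qed.

Lemma white_move s x y D v :
    x <= y -> steep b s y -> b x <= a -> bounded x y D ->
    v \in white D -> wdeg D v = x ->
  pot (v |: D) + white_gain d a b s x <= pot D.
Proof.
move=> le_xy st leba bD wv dv.
have le_pred : b x.-1 <= b x by apply: (steep_mono st); rewrite leq_pred.
have := @potential_drop a b s (b x.-1) y D v b0 st (leq_trans le_pred leba)
  (fun w => bounded_dominated bD).
rewrite /weight wv dv /white_gain => drop; apply: leq_trans (drop _) => [|u].
  rewrite leq_add2l leq_add2l leq_mul2r.
  have <- : #|fresh D v| = x.+1 by rewrite card_fresh wv dv.
  apply/orP; right; rewrite -sum_nat_const; apply: leq_sum => u.
  rewrite in_setI => /andP[_ wu]; apply: leq_trans (outer_degree D v u).
  by rewrite wv subn0 leq_sub2l // (bounded_white bD).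
rewrite in_setI in_cnbh => /andP[uv wu] neq_uv.
have {uv}uv : u \in nbh e v by rewrite (negbTE neq_uv) in uv.
(* The played vertex itself is a white neighbour that u loses. *)
have lt_x : wdeg (v |: D) u < x.
  apply: leq_trans (bounded_white bD wu).
  rewrite (wdegU1 D v u) -[X in X < _]addn0 ltn_add2l; apply/card_gt0P; exists v.
  by rewrite !in_setI in_cnbh eqxx wv nbh_sym uv.
by apply: (steep_mono st); lia.
Qed.

Lemma fresh_weight s x y D v u : x <= y -> steep b s y -> bounded x y D ->
  u \in fresh D v -> b (wdeg (v |: D) u) <= b x.
Proof.
move=> le_xy st bD; rewrite in_setI => /andP[_ wu].
apply: (steep_mono st); rewrite le_xy andbT.
exact: leq_trans (wdegU1_le D v u) (bounded_white bD wu).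
Qed.

Lemma dominated_move s x y D v :
    x <= y -> steep b s y -> b x <= a -> bounded x y D -> v \notin white D ->
  pot (v |: D) + dominated_gain d a b s x (wdeg D v) <= pot D.
Proof.
move=> le_xy st leba bD wv.
have := @potential_drop a b s (b x) y D v b0 st leba
  (fun w => bounded_dominated bD).
rewrite /weight (negbTE wv) /dominated_gain => drop.
apply: leq_trans (drop _) => [|u uX _]; last exact: (fresh_weight le_xy st bD uX).
rewrite leq_add2l -addnA leq_add2l mulnDr leq_add2l mulnA leq_mul2r.
have <- : #|fresh D v| = wdeg D v by rewrite card_fresh (negbTE wv).
apply/orP; right; rewrite -sum_nat_const; apply: leq_sum => u.
rewrite in_setI => /andP[_ wu]; apply: leq_trans (outer_degree D v u).
by rewrite wv; have := bounded_white bD wu; lia.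
Qed.

(** For a white [v], a white neighbour that becomes dominated contributes
    [a - b x >= s], no less than a dominated neighbour does, so [v] having no
    white neighbour is the worst case.  For a dominated [v], the gain grows
    with the number of white neighbours, so one is the worst case. *)
Lemma any_move s x y D v :
    x <= y -> steep b s y -> b x + s <= a -> bounded x y D -> legal e D v ->
  pot (v |: D) + any_gain d a b s x <= pot D.
Proof.
move=> le_xy st leba bD; rewrite legalE -card_gt0 card_fresh => lv.
have leba' : b x <= a by lia.
have [wv|nwv] := boolP (v \in white D).
  have := @potential_drop a b s (b x) y D v b0 st leba'
    (fun w => bounded_dominated bD).
  rewrite /weight wv => drop.
  apply: leq_trans (drop _) => [|u uX _]; last exact: (fresh_weight le_xy st bD uX).
  rewrite leq_add2l; apply: leq_trans (geq_minl _ _) _.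
  rewrite /white_gain mul0n addn0 mul1n subn0 -addnA leq_add2l.
  have vX : v \in fresh D v by rewrite in_setI in_cnbh eqxx wv.
  (* The edges at v itself suffice. *)
  rewrite (bigD1 v) //= mulnDl addnA; apply: leq_trans (leq_addr _ _).
  have := outer_degree D v v; rewrite wv subn0.
  move: (#|_ :\ v|) (wdeg D v) => m j le_m.
  apply: (leq_trans (n := (j + m) * s)); first by rewrite leq_mul2r; lia.
  by rewrite mulnDl leq_add2r leq_mul2l; lia.
have := dominated_move le_xy st leba' bD nwv.
apply: leq_trans; rewrite leq_add2l; apply: leq_trans (geq_minr _ _) _.
move: lv (bounded_dominated bD nwv); rewrite (negbTE nwv) add0n.
rewrite /dominated_gain => lv ley; apply: leq_add.
  by apply: (steep_mono st); rewrite lv.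
by rewrite leq_mul2r lv orbT.
Qed.

Definition good_move c D : Prop :=
  exists2 v, legal e D v & pot (v |: D) + c <= pot D /\
    forall w, legal e (v |: D) w -> pot (w |: (v |: D)) + 2 * c <= pot D.

Lemma profitable_move c s x y g D v :
    profitable d a c b s x y g -> bounded x y D -> legal e D v ->
    pot (v |: D) + g <= pot D ->
  good_move c D.
Proof.
move=> /and5P[le_xy st leba le_cg le_2c] bD lv gain; exists v => //.
split=> [|w lw]; first by lia.
by have := any_move le_xy st leba (boundedU1 v le_xy bD) lw; lia.
Qed.

Lemma white_good c s x y D v :
    profitable d a c b s x y (white_gain d a b s x) -> bounded x y D ->
    v \in white D -> wdeg D v = x ->
  good_move c D.
Proof.
move=> prof bD wv dv; apply: (profitable_move (v := v) prof bD).
  by rewrite legalE -card_gt0 card_fresh wv.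
have /and5P[le_xy st leba _ _] := prof.
by apply: (white_move le_xy st _ bD) => //; lia.
Qed.

Lemma dominated_good c s x y z D v :
    profitable d a c b s x y (dominated_gain d a b s x z.+1) -> bounded x y D ->
    v \notin white D -> wdeg D v = z.+1 ->
  good_move c D.
Proof.
move=> prof bD wv dv; apply: (profitable_move (v := v) prof bD).
  by rewrite legalE -card_gt0 card_fresh dv addnS.
have /and5P[le_xy st leba _ _] := prof; rewrite -dv.
by apply: (dominated_move le_xy st _ bD) => //; lia.
Qed.

End Moves.

(** * The two phases of the game *)

Section Phases.
Variables (d a c B s2 s4 : nat) (b : nat -> nat).
Hypothesis min_deg : forall v, d <= #|nbh e v|.
Hypothesis bal : balanced d a c b B s2 s4.

(** Each move is made only when the earlier ones in the list are unavailable,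
    and this unavailability is the bound that its profitability relies on. *)
Lemma sparse_good D : bounded 3 4 D -> [exists v, legal e D v] ->
  good_move a b c D.
Proof.
move: bal => /andP[/and5P[/eqP b0 _ _ _ _]].
move=> /and5P[w3 w2 d4 d3 /and3P[w1 d2 w0]] b34 /existsP[u lu].
have [[v wv dv]|b24] := bounded_white_step b34.
  exact: (white_good min_deg b0 w3 b34 wv dv).
have [[v wv dv]|b14] := bounded_white_step b24.
  exact: (white_good min_deg b0 w2 b24 wv dv).
have [[v wv dv]|b13] := bounded_dominated_step b14.
  exact: (dominated_good min_deg b0 d4 b14 wv dv).
have [[v wv dv]|b12] := bounded_dominated_step b13.
  exact: (dominated_good min_deg b0 d3 b14 wv dv).
have [[v wv dv]|b02] := bounded_white_step b12.
  exact: (white_good min_deg b0 w1 b12 wv dv).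
have [[v wv dv]|b01] := bounded_dominated_step b02.
  exact: (dominated_good min_deg b0 d2 b02 wv dv).
have /set0Pn[v] : fresh D u != set0 by rewrite -legalE.
rewrite in_setI => /andP[_ wv]; apply: (white_good min_deg b0 w0 b01 wv).
by apply/eqP; rewrite -leqn0 (bounded_white b01).
Qed.

Definition flat (i : nat) : nat := if i is 0 then 0 else B.

Lemma flat_le i : flat i <= B.
Proof. by case: i. Qed.

Lemma potential_flat D : bounded 3 4 D -> potential a b D <= potential a flat D.
Proof.
move: bal => /andP[/and5P[/eqP b0 /allP leB _ _ _] _] b34.
apply: leq_sum => w _; rewrite /weight; case: ifPn => // nw.
have := bounded_dominated b34 nw.
case: (wdeg D w) => [|i] le_i; first by rewrite b0.
by apply: leB; rewrite mem_iota.
Qed.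

(** Flat weights have slope 0 everywhere, so the trivial bound [#|T|] on the
    numbers of white neighbours suffices. *)
Lemma flat_drop D v :
  potential a flat (v |: D) + (weight a flat D v + wdeg D v * (a - B))
    <= potential a flat D.
Proof.
move: bal => /andP[/and5P[_ _ leBa _ _] _].
have st : steep flat 0 #|T|.
  by apply/allP=> -[|i] _; rewrite addn0 //= leqnn.
have := @potential_drop a flat 0 B #|T| D v erefl st leBa
  (fun w _ => max_card _) (fun u _ _ => flat_le _).
by rewrite muln0 addn0.
Qed.

Lemma game_length_potential k D : c * game_length e k true D <= potential a flat D.
Proof.
have /andP[/and5P[/eqP b0 _ leBa le_c le_2c] _] := bal.
apply: (potential_strategy (F := potential a flat) (P := fun _ => True)) => // {k}{}D _ exD.
have [/existsP[v big]|/existsPn small] := boolP [exists v, 4 < #|fresh D v|].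
  right; exists v; first by rewrite legalE -card_gt0; lia.
  have gain : potential a flat (v |: D) + (a + 4 * (a - B)) <= potential a flat D.
    apply: leq_trans (flat_drop D v); rewrite leq_add2l.
    move: big; rewrite card_fresh /weight; case: (v \in white D) => /=.
      by move=> big; rewrite leq_add2l leq_mul2r; lia.
    case: (wdeg D v) => // j big; rewrite /flat.
    apply: (leq_trans (n := B + 5 * (a - B))); first by lia.
    by rewrite leq_add2l leq_mul2r; lia.
  split=> [|w]; first by lia.
  rewrite legalE -card_gt0 card_fresh => lw; have := flat_drop (v |: D) w.
  have : a <= weight a flat (v |: D) w + wdeg (v |: D) w * (a - B).
    move: lw; rewrite /weight; case: (w \in white (v |: D)); first by rewrite leq_addr.
    case: (wdeg _ w) => // j _; rewrite /flat mulSn addnA subnKC //.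
    exact: leq_addr.
  lia.
left=> k; have b34 : bounded 3 4 D.
  apply/forallP=> w; have := small w; rewrite card_fresh -leqNgt.
  by case: (w \in white D).
apply: leq_trans (potential_flat b34).
apply: (potential_strategy (F := potential a b) (P := bounded 3 4)) => // [D' v|D' b34' ex].
  exact: boundedU1.
by right; apply: sparse_good.
Qed.

Lemma domination_number_bound : c * game_domination_number e <= a * #|T|.
Proof.
apply: leq_trans (game_length_potential _ _) _; rewrite mulnC -sum_nat_const.
apply: leq_sum => w _; rewrite /weight.
by rewrite in_setC /dominated big_set0 in_set0.
Qed.

End Phases.

End Potential.

(** * The two bounds *)

Lemma min_degree_le (T : finType) (e : rel T) v : min_degree e <= degree e v.
Proof.
by rewrite /min_degree -leEnat -minEnat; apply: Order.TotalTheory.bigmin_le_cond.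
Qed.

Lemma rat_bound (g n p q : nat) : 0 < q -> q * g <= p * n ->
  (g%:R <= p%:R * n%:R / q%:R :> rat)%R.
Proof.
move=> q_gt0 le_qp; rewrite Num.Theory.ler_pdivlMr ?Num.Theory.ltr0n //.
by rewrite -!GRing.natrM Num.Theory.ler_nat mulnC.
Qed.

Theorem corollary1 :
  (forall (T : finType) (e : rel T), symmetric e -> irreflexive e ->
     min_degree e = 4%N ->
     ((game_domination_number e)%:R <= 37%:R * #|T|%:R / 72%:R :> rat)%R)
  /\
  (forall (T : finType) (e : rel T), symmetric e -> irreflexive e ->
     (5 <= min_degree e)%N ->
     ((game_domination_number e)%:R <= 2102%:R * #|T|%:R / 4377%:R :> rat)%R).
Proof.
split=> T e e_sym e_irr min_deg; apply: rat_bound => //.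
  have deg4 v : 4 <= #|nbh e v| by rewrite -min_deg; apply: min_degree_le.
  by have := domination_number_bound e_sym e_irr deg4 balanced4; lia.
have deg5 v : 5 <= #|nbh e v| := leq_trans min_deg (min_degree_le e v).
exact: (domination_number_bound e_sym e_irr deg5 balanced5).
Qed.
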